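(* Let $T$ be a tree on $n\ge 2$ vertices with $T\neq P_n$, and let $i\in V(T)$. (1) If $(T,i)$ allows $(k,\ell)$ with the SNIP, then $k\le 1$ or $\ell\le 1$. (2) $(T,i)$ allows $(2,1)$ and $(1,1)$ with the SNIP if and only if $T$ has a vertex $v\ne i$ of degree at least $3$. (3) $(T,i)$ allows $(1,2)$ with the SNIP if and only if $T$ contains a vertex $v\neq i$ of degree at least $3$ that is not adjacent to $i$.
   Context: All matrices are real. $P_n$ is the path on $n$ vertices. For a simple graph $G$ on $[n]$, $\mathcal{S}(G)$ is the set of real symmetric $n\times n$ matrices whose off-diagonal $(j,k)$ entry is nonzero iff $\{j,k\}\in E(G)$ (diagonal free). $A(i)$ is $A$ with row and column $i$ deleted. $A$ has the $i$-SNIP if $X=O$ is the only real symmetric $X$ with $A\circ X=O$, $I\circ X=O$ and $(AX)(i,:]=O$ ($AX$ with row $i$ deleted). $(G,i)$ allows $(k,\ell)$ with the SNIP if some $A\in\mathcal{S}(G)$ with the $i$-SNIP has $(\operatorname{null}(A),\operatorname{null}(A(i)))=(k,\ell)$. *)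

(* Defs.v *)
From mathcomp Require Import all_boot all_order all_algebra.
From mathcomp Require Import reals.

Set Implicit Arguments.
Unset Strict Implicit.
Unset Printing Implicit Defensive.

Import GRing.Theory.
Local Open Scope ring_scope.

Section Graphs.
Variable n : nat.
Implicit Types G H : rel 'I_n.

Definition simple_graph G : Prop := symmetric G /\ irreflexive G.

Definition connected_graph G : Prop := forall x y, connect G x y.

(* The edge traversed back and forth is a ucycle of size 2, hence the bound. *)
Definition acyclic_graph G : Prop := forall c, ucycle G c -> (size c <= 2)%N.

Definition tree G : Prop :=
  [/\ simple_graph G, connected_graph G & acyclic_graph G].

Definition path_graph : rel 'I_n :=
  [rel x y : 'I_n | (x.+1 == y :> nat) || (y.+1 == x :> nat)].

Definition graph_iso G H : Prop :=
  exists2 f : 'I_n -> 'I_n, bijective f & forall x y, H (f x) (f y) = G x y.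

Definition degree G (v : 'I_n) : nat := #|[pred w | G v w]|.

End Graphs.

Section NullityPairs.
Variables (R : realType) (n : nat).
Implicit Types (G : rel 'I_n) (A : 'M[R]_n) (i : 'I_n).

Definition in_S G A : Prop :=
  A^T = A /\ forall j k : 'I_n, j != k -> (A j k != 0) = G j k.

Definition hadamard m p (A B : 'M[R]_(m, p)) : 'M[R]_(m, p) :=
  map2_mx *%R A B.

(* kermx is a left kernel: the transpose gives the x with A *m x = 0. *)
Definition nullity m (A : 'M[R]_m) : nat := \rank (kermx A^T).

Definition principal_del A i : 'M[R]_n.-1 := row' i (col' i A).

Definition SNIP A i : Prop :=
  forall X : 'M[R]_n,
    X^T = X -> hadamard A X = 0 -> hadamard 1%:M X = 0 ->
    row' i (A *m X) = 0 -> X = 0.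

Definition allows_SNIP G i (k l : nat) : Prop :=
  exists A : 'M[R]_n,
    [/\ in_S G A, SNIP A i, nullity A = k & nullity (principal_del A i) = l].

End NullityPairs.

Arguments path_graph n : clear implicits.
Arguments allows_SNIP R {n} G i k l.

(* Main.v *)
Require Import Defs.
From mathcomp Require Import all_boot all_order all_algebra.
From mathcomp Require Import boolp reals.
From mathcomp Require Import zify ring lra.

(**
The SNIP only sees the space [V] of vectors [x] such that [A x] vanishes outside
the coordinate [i]. If [y], [z] in [V] are nonzero and no vertex or edge joins
their supports, then [X = y z^T + z y^T] violates the SNIP.

Part 1. If [dim V >= 3], such a pair exists. At a vertex [p], look at the vectors
of [V] vanishing at [p] and at their restrictions to the branches of [T - p].
Either four neighbours of [p] (two, when [p = i]) carry nonzero entries and the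
corresponding branches can be paired off into [y] and [z], or some neighbour [q]
has a nonzero vector of [V] supported on its branch and vanishing at [q]. In the
second case let [p] point to [q]; two pointers must face each other along an edge,
and the two vectors there are separated. Hence the SNIP gives [dim V <= 2], and a
rank computation bounds one of the two nullities by 1.

Parts 2 and 3, necessity. A vector vanishing at two adjacent vertices vanishes
along every chain of vertices of degree at most 2 behind them. Without a suitable
vertex of degree at least 3, this again yields a separated pair or contradicts
the nullities.

Parts 2 and 3, sufficiency. Delete [v] (and also [i] for the pair (1, 2)). Take
the Laplacian on three of the components adjacent to [v], one of them lying
towards [i], and the Laplacian plus the identity on the others. Then [V] consists
of the combinations, with coefficients of sum zero, of the three indicator
vectors; adding 1 to the entry [(i, i)] turns (2, 1) into (1, 1).
*)

Set Implicit Arguments.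
Unset Strict Implicit.
Unset Printing Implicit Defensive.

Import Order.TTheory GRing.Theory Num.Theory.

(** * Branches of a tree *)

Section Branches.
Variables (n : nat) (T : rel 'I_n).
Hypothesis treeT : tree T.
Implicit Types (D : {set 'I_n}) (p q x y z : 'I_n).

(** Vertices of [D] stay as isolated points, so [T - D] needs no new vertex type. *)
Definition avoiding D : rel 'I_n :=
  [rel x y | [&& T x y, x \notin D & y \notin D]].

Definition component D q : pred 'I_n := connect (avoiding D) q.

Definition branch p q := component [set p] q.

Lemma tree_sym : symmetric T. Proof. by case: treeT => -[]. Qed.

Lemma tree_irr : irreflexive T. Proof. by case: treeT => -[]. Qed.

Lemma edge_neq x y : T x y -> x != y.
Proof. by apply: contraTneq => ->; rewrite tree_irr. Qed.

Lemma avoiding_sym D : symmetric (avoiding D).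
Proof.
by move=> x y; rewrite /avoiding /= tree_sym; congr (_ && _); rewrite andbC.
Qed.

Lemma component_sym D x y : component D x y = component D y x.
Proof. exact: (sym_connect_sym (avoiding_sym D)). Qed.

Lemma component_root D q : component D q q.
Proof. exact: connect0. Qed.

Lemma branch_root p q : branch p q q.
Proof. exact: connect0. Qed.

Lemma avoiding_path D q s : path (avoiding D) q s ->
  path T q s /\ {in s, forall x, x \notin D}.
Proof.
elim: s q => //= y s IHs q /andP[/and3P[-> _ yD] /IHs[-> sD]]; split=> // x.
by rewrite inE => /predU1P[-> // | /sD].
Qed.

Lemma component_notin D q x : q \notin D -> component D q x -> x \notin D.
Proof.
move=> qD /connectP[s /avoiding_path[_ sD] ->].
by have:= mem_last q s; rewrite inE => /predU1P[-> // | /sD].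
Qed.

Lemma component_step D q x y : component D q x -> T x y ->
  x \notin D -> y \notin D -> component D q y.
Proof.
move=> qx xy xD yD; apply: connect_trans qx (connect1 _).
by rewrite /avoiding /= xy xD.
Qed.

Lemma component_sub D D' q x :
  D \subset D' -> component D' q x -> component D q x.
Proof.
move=> sDD'; apply: connect_sub => {q x} x y /and3P[xy xD yD].
apply: connect1; rewrite /avoiding /= xy.
by rewrite (contra (subsetP sDD' _) xD) (contra (subsetP sDD' _) yD).
Qed.

(* A path between two distinct neighbours of [p] that avoids [p] would close
   up to a cycle through [p]. *)
Lemma component_neighbor D p q q' : p \in D -> T p q -> T p q' ->
  component D q q' -> q = q'.
Proof.
move=> pD pq pq' /connectP[s0 s0P ql]; rewrite {q'}ql in pq' *.
case/shortenP: s0P pq' => s /avoiding_path[sT sD] us _ pl.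
have: size [:: p, q & s] <= 2.
  case: treeT => _ _; apply; rewrite /ucycle /= rcons_path pq sT /=.
  rewrite tree_sym pl -[_ && uniq s]/(uniq (q :: s)) us inE negb_or.
  rewrite edge_neq // andbT /=.
  by apply/negP=> /sD; rewrite pD.
by case: s {sT sD us pl}.
Qed.

Lemma branch_neq p q x : T p q -> branch p q x -> x != p.
Proof.
by move=> pq /component_notin; rewrite !inE eq_sym => -> //; apply: edge_neq.
Qed.

Lemma branch_step p q x y : T p q -> branch p q x -> T x y -> y != p ->
  branch p q y.
Proof.
move=> pq qx xy yp; apply: (component_step qx xy); rewrite inE //.
exact: branch_neq qx.
Qed.

Lemma branch_inj p q q' x : T p q -> T p q' ->
  branch p q x -> branch p q' x -> q = q'.
Proof.
move=> pq pq' qx; rewrite /branch component_sym => xq'.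
by apply: (component_neighbor (set11 p)) => //; apply: connect_trans xq'.
Qed.

Lemma branch_exit p q x : T p q -> branch p q x -> T p x -> x = q.
Proof.
move=> pq qx px; apply: branch_inj qx => //; exact: branch_root.
Qed.

(** A repetition-free path from [p] to [x] meets [p] only at its start; [q] is its second vertex. *)
Lemma branchP p x : x != p -> exists2 q, T p q & branch p q x.
Proof.
move=> xp; have [_ /(_ p x)/connectP[s0 s0P xl] _] := treeT.
case/shortenP: s0P xl xp => -[|q s] /= + + _ ->; first by rewrite eqxx.
case/andP=> pq qs /and3P[ps _ _] _; exists q => //; apply/connectP.
exists s => //; move: ps qs; elim: s {pq} q => //= y s IHs q.
rewrite !inE !negb_or => /and3P[pq py ps] /andP[qy ys] /=.
by rewrite /avoiding /= qy !inE ![_ == p]eq_sym pq py IHs // inE negb_or py.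
Qed.

(** The only edge leaving [branch p q] is [qp], so its complement, which contains [p], is closed
    under steps avoiding [q]. *)
Lemma branch_disjoint p q x : T p q -> branch p q x -> ~~ branch q p x.
Proof.
move=> pq; apply: contraL => px; suff: x \in [predC branch p q] by [].
have closedC : closed (avoiding [set q]) [predC branch p q].
  apply: (intro_closed (sym_connect_sym (avoiding_sym _))).
  move=> y z /and3P[yz]; rewrite !inE => yq zq; apply: contra => qz.
  have [yp|yp] := eqVneq y p.
    by rewrite (branch_exit pq qz) ?eqxx // -yp in zq.
  by apply: branch_step qz _ yp; rewrite // tree_sym.
rewrite -(closed_connect closedC px) inE.
by apply/negP => /(branch_neq pq); rewrite eqxx.
Qed.

(** With [q] removed, nothing leads out of [branch p q]. Hence branches shrink along pointers that
    do not turn back. *)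
Lemma branch_proper p q r : T p q -> T q r -> r != p ->
  {subset branch q r <= [predD1 branch p q & q]}.
Proof.
move=> pq qr rp x rx; rewrite !inE (branch_neq qr rx) /=.
have closedB : closed (avoiding [set q]) (branch p q).
  apply: (intro_closed (sym_connect_sym (avoiding_sym _))).
  move=> y z /and3P[yz]; rewrite !inE => yq zq qy.
  apply: (branch_step pq qy yz); apply: contraNneq yq => zp.
  by apply/eqP; apply: (branch_exit pq qy); rewrite tree_sym -zp.
rewrite -[branch p q x]/(x \in branch p q) -(closed_connect closedB rx).
by apply: (branch_step pq _ qr rp); apply: branch_root.
Qed.

End Branches.

(** * Null vectors outside one coordinate *)

Section NullVectors.
Local Open Scope ring_scope.
Variables (R : realType) (n : nat) (T : rel 'I_n) (i : 'I_n) (A : 'M[R]_n).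
Hypotheses (treeT : tree T) (AT : in_S T A).
Implicit Types (p q : 'I_n) (x y z w : 'I_n -> R).

Definition mxapp m (M : 'M[R]_m) (x : 'I_m -> R) j := \sum_k M j k * x k.

(* The columns of every [X] tested by the [i]-SNIP satisfy [offnull]. *)
Definition offnull x := forall j, j != i -> mxapp A x j = 0.

Definition restrict p q x j := if branch T p q j then x j else 0.

Lemma in_S_sym j k : A j k = A k j.
Proof. by case: AT => /matrixP/(_ k j); rewrite mxE. Qed.

Lemma in_S_edge j k : T j k -> A j k != 0.
Proof. by move=> jk; case: AT => _ ->//; apply: edge_neq jk. Qed.

Lemma in_S_nonedge j k : j != k -> ~~ T j k -> A j k = 0.
Proof. by case: AT => _ E /E <- /negPn/eqP. Qed.

Lemma mxapp_sym x y : \sum_j y j * mxapp A x j = \sum_j mxapp A y j * x j.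
Proof.
under eq_bigr do rewrite mulr_sumr; rewrite exchange_big /=.
apply: eq_bigr => k _; rewrite mulr_suml; apply: eq_bigr => j _.
by rewrite in_S_sym mulrA [y j * _]mulrC.
Qed.

Lemma mxapp_lin a b x y j :
  mxapp A (fun k => a * x k + b * y k) j = a * mxapp A x j + b * mxapp A y j.
Proof.
rewrite !mulr_sumr -big_split /=; apply: eq_bigr => k _.
by rewrite mulrDr !mulrA ![A j k * _]mulrC.
Qed.

Lemma separated_not_SNIP y z a b : offnull y -> offnull z ->
    y a != 0 -> z b != 0 ->
    (forall j k, y j != 0 -> z k != 0 -> (j != k) && ~~ T j k) ->
  ~ SNIP A i.
Proof.
move=> Vy Vz ya zb sep.
have yz0 j k : (j == k) || T j k -> y j * z k = 0.
  apply: contraTeq; rewrite mulf_eq0 negb_or => /andP[yj zk].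
  by rewrite negb_or sep.
pose X := \matrix_(j, k) (y j * z k + z j * y k).
have X0 j k : (j == k) || T j k -> X j k = 0.
  move=> jk; rewrite mxE yz0 // mulrC yz0 ?addr0 //.
  by rewrite eq_sym (tree_sym treeT).
(* [X a b] reduces to [y a * z b], since [y a * z a = 0] gives [z a = 0]. *)
move=> snip; suff /matrixP/(_ a b)/eqP : X = 0.
  have /eqP : y a * z a = 0 by apply: yz0; rewrite eqxx.
  rewrite !mxE mulf_eq0 (negPf ya) => /eqP->.
  by rewrite mul0r addr0 mulf_eq0 (negPf ya) (negPf zb).
apply: snip.
- by apply/matrixP=> j k; rewrite !mxE addrC; congr (_ + _); rewrite mulrC.
- apply/matrixP=> j k; rewrite !mxE.
  have [jk|njk] := boolP ((j == k) || T j k).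
    by have := X0 _ _ jk; rewrite mxE => ->; rewrite mulr0.
  by move: njk; rewrite negb_or => /andP[/in_S_nonedge E /E->]; rewrite mul0r.
- apply/matrixP=> j k; have [<-|jk] := eqVneq j k.
    by have := X0 j j; rewrite !mxE eqxx => ->; rewrite ?mulr0.
  by rewrite !mxE (negPf jk) mul0r.
- apply/matrixP=> j k; rewrite [LHS]mxE [LHS]mxE [RHS]mxE.
  set l := lift i j.
  transitivity (z k * mxapp A y l + y k * mxapp A z l); last first.
    by rewrite Vy ?Vz ?mulr0 ?addr0 // /l eq_sym neq_lift.
  rewrite -mxapp_lin; apply: eq_bigr => h _; rewrite mxE.
  by congr (_ * (_ + _)); rewrite mulrC.
Qed.

(** As [x p = 0] and [pq] is the only edge leaving the branch, truncation alters no row inside it;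
    outside, only row [p] meets the branch, and only at [q]. *)
Lemma mxapp_restrict p q x j : T p q -> x p = 0 ->
  mxapp A (restrict p q x) j = if branch T p q j then mxapp A x j
    else if j == p then A p q * x q else 0.
Proof.
move=> pq xp; case: ifP => [qj | /negP qj].
  apply: eq_bigr => k _; rewrite /restrict; case: ifP => // /negP qk.
  have [->|kp] := eqVneq k p; first by rewrite xp.
  rewrite in_S_nonedge ?mul0r //; first by apply: contraPneq qk => <-.
  by apply: contra_notN qk => jk; apply: branch_step qj jk kp.
have [->|jp] := eqVneq j p.
  rewrite /mxapp (bigD1 q) //= {1}/restrict branch_root big1 ?addr0 // => k kq.
  rewrite /restrict; case: ifP; rewrite ?mulr0 // => qk.
  rewrite in_S_nonedge ?mul0r //.
    by rewrite eq_sym; apply: branch_neq qk.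
  by apply: contra kq => pk; apply/eqP/(branch_exit treeT pq qk pk).
apply: big1 => k _; rewrite /restrict; case: ifP; rewrite ?mulr0 // => qk.
rewrite in_S_nonedge ?mul0r //; first by apply: contra_not_neq qj => ->.
apply: contra_notN qj => jk; apply: (branch_step treeT pq qk) jp.
by rewrite (tree_sym treeT).
Qed.

Lemma restrict_neq0 p q x j : restrict p q x j != 0 -> branch T p q j.
Proof. by rewrite /restrict; case: ifP; rewrite // eqxx. Qed.

(** The one row that truncation can spoil is [p]: it is exempt if [p = i], and it vanishes if
    [x q = 0]. *)
Lemma offnull_restrict p q x : T p q -> offnull x -> x p = 0 ->
  p = i \/ x q = 0 -> offnull (restrict p q x).
Proof.
move=> pq Vx xp pi j ji; rewrite mxapp_restrict // Vx //; case: ifP => // _.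
have [jp|//] := eqVneq j p; case: pi => [pi|->]; last by rewrite mulr0.
by rewrite jp pi eqxx in ji.
Qed.

Lemma branch_separated p q q' j k : T p q -> T p q' -> q != q' ->
  branch T p q j -> branch T p q' k -> (j != k) && ~~ T j k.
Proof.
move=> pq pq' qq' qj qk; apply/andP; split.
  apply: contraNneq qq' => jk; rewrite -jk in qk.
  exact/eqP/(branch_inj treeT pq pq' qj qk).
apply: contra qq' => jk; apply/eqP/(branch_inj treeT pq pq' _ qk).
by apply: (branch_step treeT pq qj jk); apply: branch_neq qk.
Qed.

(* [u := restrict p q w] satisfies [A u = (A p q * w q) e_p], so symmetry of
   [A] forces the [p]-entry of [x] to vanish. *)
Lemma active_branch_vanish p q w x : T p q -> w p = 0 -> w q != 0 ->
    offnull w -> offnull x -> ~~ branch T p q i -> x p = 0.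
Proof.
move=> pq wp wq Vw Vx qi; have := mxapp_sym x (restrict p q w).
rewrite big1 => [|j _]; last first.
  have [->|/Vx->] := eqVneq j i; last by rewrite mulr0.
  by rewrite /restrict (negPf qi) mul0r.
rewrite (bigD1 p) //= big1 ?addr0 => [/esym/eqP|j jp]; last first.
  rewrite mxapp_restrict // (negPf jp); case: ifP; rewrite ?mul0r // => qj.
  by rewrite Vw ?mul0r //; apply: contraNneq qi => <-.
rewrite mxapp_restrict // eqxx ifN; last first.
  by apply/negP=> /(branch_neq treeT pq); rewrite eqxx.
by rewrite !mulf_eq0 (negPf (in_S_edge pq)) (negPf wq) => /eqP.
Qed.

Lemma second_neighbor p q w : mxapp A w p = 0 -> w p = 0 -> T p q ->
  w q != 0 -> exists q', [/\ T p q', q' != q & w q' != 0].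
Proof.
move=> Aw wp pq wq.
have [/existsP[q' /and3P[]]|] :=
  boolP [exists q', [&& T p q', q' != q & w q' != 0]]; first by exists q'.
rewrite negb_exists => /forallP nq'; move/eqP: Aw.
rewrite /mxapp (bigD1 q) //= big1 ?addr0 => [|k kq].
  by rewrite mulf_eq0 (negPf (in_S_edge pq)) (negPf wq).
have [<-|pk] := eqVneq p k; first by rewrite wp mulr0.
have := nq' k; rewrite kq /= negb_and => /orP[/in_S_nonedge->//|].
  by rewrite mul0r.
by rewrite negbK => /eqP->; rewrite mulr0.
Qed.

(* Two summands [restrict p q w] balanced so that row [p] vanishes. *)
Lemma balanced_pair p q q' w : T p q -> T p q' -> q != q' ->
    w p = 0 -> w q != 0 -> w q' != 0 -> offnull w ->
  exists y, [/\ offnull y, y q != 0 &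
    forall j, y j != 0 -> branch T p q j || branch T p q' j].
Proof.
move=> pq pq' qq' wp wq wq' Vw.
pose a := A p q' * w q'; pose b := - (A p q * w q).
have notin r : T p r -> branch T p r p = false.
  by move=> pr; apply/negP=> /(branch_neq treeT pr); rewrite eqxx.
exists (fun j => a * restrict p q w j + b * restrict p q' w j); split.
- move=> j ji; rewrite mxapp_lin !mxapp_restrict // Vw //.
  have [->|jp] := eqVneq j p; last by rewrite !if_same !mulr0 addr0.
  by rewrite !notin // /a /b; ring.
- rewrite /restrict branch_root ifN; last first.
    apply: contra qq' => q'q; apply/eqP.
    by apply: (branch_inj treeT pq pq' _ q'q); apply: branch_root.
  rewrite mulr0 addr0 /a !mulf_eq0 (negPf wq) (negPf wq').
  by rewrite (negPf (in_S_edge pq')).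
move=> j; apply: contraR; rewrite negb_or /restrict => /andP[/negPf-> /negPf->].
by rewrite !mulr0 addr0.
Qed.

(** The form in which dimension at least 3 is used: two linear conditions still leave a nonzero
    vector. *)
Definition many_null := forall j1 j2,
  exists w, [/\ offnull w, exists a, w a != 0, w j1 = 0 & w j2 = 0].

(** If no such [q] exists, every nonzero [offnull] vector vanishing at [p] is nonzero at a neighbour
    of [p], and two such vectors yield a separated pair. *)
Lemma inactive_branch p : many_null -> SNIP A i -> exists q, T p q /\
  exists y, [/\ offnull y, y q = 0, exists a, y a != 0
    & forall j, y j != 0 -> branch T p q j].
Proof.
move=> many snip; apply: contrapT => noq.
have zero w q j : offnull w -> w p = 0 -> T p q -> w q = 0 ->
    branch T p q j -> w j = 0.
  move=> Vw wp pq wq qj; apply/eqP/negPn/negP => wj; apply: noq.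
  exists q; split=> //; exists (restrict p q w); split.
  - by apply: offnull_restrict => //; right.
  - by rewrite /restrict branch_root.
  - by exists j; rewrite /restrict qj.
  - exact: restrict_neq0.
have active w : offnull w -> w p = 0 -> (exists a, w a != 0) ->
    exists2 q, T p q & w q != 0.
  move=> Vw wp [a wa]; have ap : a != p by apply: contraNneq wa => ->; rewrite wp.
  have [q pq qa] := branchP treeT ap; exists q => //.
  by apply: contraNneq wa => wq; rewrite (zero w q).
have [w1 [Vw1 n1 w1p _]] := many p p; have [q1 pq1 w1q1] := active _ Vw1 w1p n1.
(* For [p = i], row [p] is unconstrained, so each restriction to a branch is admissible by
   itself. *)
have [pi|pi] := eqVneq p i.
  have [w2 [Vw2 n2 w2p w2q1]] := many p q1.
  have [q2 pq2 w2q2] := active _ Vw2 w2p n2.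
  have q12 : q1 != q2 by apply: contraNneq w2q2 => <-; rewrite w2q1.
  apply: (@separated_not_SNIP (restrict p q1 w1) (restrict p q2 w2) q1 q2) => //.
  - by apply: offnull_restrict => //; left.
  - by apply: offnull_restrict => //; left.
  - by rewrite /restrict branch_root.
  - by rewrite /restrict branch_root.
  - move=> j k /restrict_neq0 q1j /restrict_neq0 q2k.
    exact: branch_separated q1j q2k.
have [q2 [pq2 q21 w1q2]] := second_neighbor (Vw1 _ pi) w1p pq1 w1q1.
(* [i] lies in at most one of the two branches; the other one forces [x p = 0]. Both conditions of
   [many] can then be spent on [q1] and [q2]. *)
have Vp x : offnull x -> x p = 0.
  move=> Vx; have [q1i|q1i] := boolP (branch T p q1 i).
    apply: (active_branch_vanish pq2 w1p) => //.
    apply: contra q21 => q2i; apply/eqP; exact: branch_inj q2i q1i.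
  exact: (active_branch_vanish pq1 w1p).
have [w2 [Vw2 n2 w2q1 w2q2]] := many q1 q2; have w2p := Vp _ Vw2.
have [q3 pq3 w2q3] := active _ Vw2 w2p n2.
have [q4 [pq4 q43 w2q4]] := second_neighbor (Vw2 _ pi) w2p pq3 w2q3.
have neq q : w2 q != 0 -> (q1 != q) && (q2 != q).
  by move=> wq; apply/andP; split; apply: contraNneq wq => <-; apply/eqP.
have /andP[q13 q23] := neq _ w2q3; have /andP[q14 q24] := neq _ w2q4.
rewrite eq_sym in q21; rewrite eq_sym in q43.
have [y [Vy yq1 ysub]] := balanced_pair pq1 pq2 q21 w1p w1q1 w1q2 Vw1.
have [z [Vz zq3 zsub]] := balanced_pair pq3 pq4 q43 w2p w2q3 w2q4 Vw2.
apply: (separated_not_SNIP Vy Vz yq1 zq3) snip => j k.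
by case/ysub/orP=> qj /zsub/orP[] qk; apply: branch_separated qj qk.
Qed.

(* The pointers [p -> q] of [inactive_branch] must face each other on some
   edge: otherwise their branches would shrink forever. *)
Lemma many_null_not_SNIP : many_null -> ~ SNIP A i.
Proof.
move=> many snip.
have /fin_all_exists[f fP] p := inactive_branch p many snip.
case: (@arg_minnP _ i xpredT (fun p => #|branch T p (f p)|) isT) => p _ minp.
have [pq [y [Vy yq [a ya] ysub]]] := fP p.
have [qr [z [Vz zr [b zb] zsub]]] := fP (f p).
have [rp|rp] := eqVneq (f (f p)) p; last first.
  have := minp (f p) isT; rewrite leqNgt; case/negP.
  rewrite [X in (_ < X)%N](cardD1 (f p)) /in_mem /= branch_root ltnS.
  by apply/subset_leq_card/subsetP; apply: branch_proper.
rewrite {}rp in zr zsub qr.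
apply: (separated_not_SNIP Vy Vz ya zb) snip => j k yj /[dup] zk /zsub pk.
have qj := ysub _ yj; apply/andP; split.
  by apply: contraTneq pk => <-; apply: branch_disjoint.
(* The only edge between the two sides joins [p] and [f p], and [z] vanishes at [p]. *)
apply: contraTN pk => jk; apply: (branch_disjoint treeT pq).
by apply: (branch_step treeT pq qj jk); apply: contraNneq zk => ->; apply/eqP.
Qed.

Lemma degree_le2 v r s t : ~~ (3 <= degree T v)%N ->
  T v r -> T v s -> r != s -> T v t -> (t == r) || (t == s).
Proof.
move=> dv vr vs rs vt; apply: contraR dv; rewrite negb_or => /andP[tr ts].
have/card_uniqP/= <- : uniq [:: r; s; t].
  by rewrite /= !inE negb_or rs ![_ == t]eq_sym tr ts.
by apply/subset_leq_card/subsetP=> k; rewrite !inE => /or3P[]/eqP->.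
Qed.

(** A vertex [q] of degree at most 2 has at most one neighbour [r] besides [p], so row [q] reduces
    to [A q r * x r = 0]; this repeats along the path to [j]. *)
Lemma propagate p q x : T p q -> x p = 0 -> x q = 0 ->
    (forall j, branch T p q j -> mxapp A x j = 0 /\ ~~ (3 <= degree T j)%N) ->
  forall j, branch T p q j -> x j = 0.
Proof.
move=> pq xp xq H j /connectP[s0 s0P ->].
case/shortenP: s0P => s sP us _.
have {H} : {in q :: s, forall j, mxapp A x j = 0 /\ ~~ (3 <= degree T j)%N}.
  move=> k ks; apply: H; exact: (path_connect sP).
have {us} : uniq [:: p, q & s].
  rewrite cons_uniq us andbT inE negb_or (edge_neq treeT pq) /=.
  by apply/negP=> /(avoiding_path sP).2; rewrite inE eqxx.
have [{}sP _] := avoiding_path sP.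
elim: s p q pq xp xq sP => //= r s IHs p q pq xp xq /andP[qr rs] us H.
have [Aq dq] := H q (mem_head _ _).
have pr : p != r by move: us; rewrite !inE !negb_or => /and4P[/and3P[]].
apply: (IHs q r) => //.
- move/eqP: Aq; rewrite /mxapp (bigD1 r) //= big1 ?addr0 => [|k kr].
    by rewrite mulf_eq0 (negPf (in_S_edge qr)) => /eqP.
  have [<-|qk] := eqVneq q k; first by rewrite xq mulr0.
  have [Tqk|/in_S_nonedge->//] := boolP (T q k); last by rewrite mul0r.
  have /orP[/eqP->|/idPn] : (k == p) || (k == r).
  + by apply: degree_le2 Tqk; rewrite // (tree_sym treeT).
  + by rewrite xp mulr0.
  + by rewrite kr.
- by case/andP: us.
- by move=> k ks; apply: H; rewrite inE ks orbT.
Qed.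

(** Otherwise propagation makes [w] nonzero at a neighbour of [i], and row [i] then at a second one;
    the restrictions of [w] to their branches are separated. *)
Lemma null_vector_high_degree w : SNIP A i -> (forall j, mxapp A w j = 0) ->
  w i = 0 -> (exists a, w a != 0) -> exists v, v <> i /\ (3 <= degree T v)%N.
Proof.
move=> snip Aw wi [a wa]; apply: contrapT => nov.
have ai : a != i by apply: contraNneq wa => ->; rewrite wi.
have [q iq qa] := branchP treeT ai.
have wq : w q != 0.
  apply: contraNneq wa => wq; rewrite (propagate iq wi wq _ qa) // => j qj.
  split=> //; apply/negP=> dj; apply: nov; exists j; split=> //.
  by apply/eqP; apply: branch_neq qj.
have [q' [iq' q'q wq']] := second_neighbor (Aw i) wi iq wq.
have Vw : offnull w by move=> j _.
apply: (@separated_not_SNIP (restrict i q w) (restrict i q' w) q q') => //.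
- by apply: offnull_restrict => //; left.
- by apply: offnull_restrict => //; left.
- by rewrite /restrict branch_root.
- by rewrite /restrict branch_root.
- move=> j k /restrict_neq0 qj /restrict_neq0 qk.
  by rewrite eq_sym in q'q; apply: branch_separated qj qk.
Qed.

(** A nonzero entry of [w] in another branch at [i] gives a vector separated from [x] on the branch
    of [q]. Within the branch of [q], propagation makes [w] nonzero at a neighbour [c] of [q], which
    forces [x q = 0]. *)
Lemma null_vector_far_high_degree q x w : SNIP A i -> T i q ->
    offnull x -> x i = 0 -> x q != 0 ->
    offnull w -> w i = 0 -> w q = 0 -> (exists a, w a != 0) ->
  exists v, [/\ v <> i, (3 <= degree T v)%N & ~~ T v i].
Proof.
move=> snip iq Vx xi xq Vw wi wq [a wa]; apply: contrapT => nov.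
have qi : T q i by rewrite (tree_sym treeT).
have ai : a != i by apply: contraNneq wa => ->; rewrite wi.
have [q' iq' q'a] := branchP treeT ai.
have [qq'|qq'] := eqVneq q q'; last first.
  apply: (@separated_not_SNIP (restrict i q x) (restrict i q' w) q a) => //.
  - by apply: offnull_restrict => //; left.
  - by apply: offnull_restrict => //; left.
  - by rewrite /restrict branch_root.
  - by rewrite /restrict q'a.
  - move=> j k /restrict_neq0 qj /restrict_neq0 qk.
    exact: branch_separated qj qk.
rewrite -{q'}qq' in q'a iq'.
have aq : a != q by apply: contraNneq wa => ->; rewrite wq.
have [c qc ca] := branchP treeT aq.
have nci : ~~ branch T q c i.
  apply/negP=> ci; have ic := branch_exit treeT qc ci qi; rewrite -ic in ca.
  by have := branch_disjoint treeT iq q'a; rewrite ca.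
have wc : w c != 0.
  apply: contraNneq wa => wc; rewrite (propagate qc wq wc _ ca) // => j cj.
  have ji : j != i by apply: contraNneq nci => <-.
  split; first exact: Vw.
  apply/negP=> dj; apply: nov; exists j; split=> //; first exact/eqP.
  (* A vertex adjacent to [i] would pull [i] into the branch of [c]. *)
  apply: contra nci => Tji; apply: (branch_step treeT qc cj Tji).
  exact: (edge_neq treeT iq).
by move: xq; rewrite (active_branch_vanish qc wq wc Vw Vx nci) eqxx.
Qed.

End NullVectors.

(** * Nullities *)

Section Nullity.
Local Open Scope ring_scope.
Variable R : realType.

Lemma nullityE m (M : 'M[R]_m) : nullity M = (m - \rank M)%N.
Proof. by rewrite /nullity mxrank_ker mxrank_tr. Qed.

(** Coordinate rows for [s] are stacked under [M]; the rank of the result is still less than [m]. *)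
Lemma ker_vanish m p (M : 'M[R]_(p, m)) (s : seq 'I_m) :
    (\rank M + size s < m)%N ->
  exists x : 'I_m -> R, [/\ forall r, \sum_k M r k * x k = 0,
    exists a, x a != 0 & {in s, forall j, x j = 0}].
Proof.
move=> rkM; pose F : 'M[R]_(size s, m) :=
  \matrix_(a, k) (k == tnth (in_tuple s) a)%:R.
have: kermx (col_mx M F)^T != 0.
  rewrite -mxrank_eq0 mxrank_ker mxrank_tr -lt0n subn_gt0.
  apply: leq_ltn_trans rkM; rewrite -addsmxE.
  apply: leq_trans (mxrank_adds_leqif _ _) _.
  by rewrite leq_add2l rank_leq_row.
case/rowV0Pn=> v /sub_kermxP; rewrite tr_col_mx mul_mx_row.
move=> /eqP; rewrite -row_mx0 => /eqP/eq_row_mx[vM vF] v0.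
exists (v 0); split.
- move=> r; have /matrixP/(_ 0 r) := vM; rewrite !mxE => vM0.
  by rewrite -[RHS]vM0; apply: eq_bigr => k _; rewrite !mxE mulrC.
- by have /matrix0Pn[b [a va]] := v0; exists a; rewrite [b]ord1 in va.
move=> j /seq_tnthP[a ->]; have /matrixP/(_ 0 a) := vF; rewrite !mxE.
rewrite (bigD1 (tnth (in_tuple s) a)) //= !mxE eqxx mulr1 big1 ?addr0 // => k kj.
by rewrite !mxE (negPf kj) mulr0.
Qed.

(** Duality of [E] to the coordinates [c] gives independence; the last hypothesis gives spanning. *)
Lemma nullity_eq m k (M : 'M[R]_m) (E : 'I_k -> 'I_m -> R) (c : 'I_k -> 'I_m) :
    (forall a b, E a (c b) = (a == b)%:R) ->
    (forall a j, mxapp M (E a) j = 0) ->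
    (forall x, (forall j, mxapp M x j = 0) ->
       forall j, x j = \sum_a x (c a) * E a j) ->
  nullity M = k.
Proof.
move=> Ec ME spanE; pose B : 'M[R]_(k, m) := \matrix_(a, j) E a j.
have /eqmxP kerB : (kermx M^T == B)%MS.
  apply/andP; split; last first.
    apply/sub_kermxP/matrixP=> a j; rewrite !mxE -[RHS](ME a j).
    by apply: eq_bigr => h _; rewrite !mxE mulrC.
  apply/rV_subP=> v /sub_kermxP vM; apply/submxP.
  exists (\row_a v 0 (c a)); apply/rowP=> j; rewrite [RHS]mxE [LHS]spanE.
    by apply: eq_bigr => a _; rewrite !mxE.
  move=> h; have /matrixP/(_ 0 h) := vM; rewrite !mxE => vM0.
  by rewrite -[RHS]vM0; apply: eq_bigr => l _; rewrite !mxE mulrC.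
rewrite /nullity kerB; apply/eqP/row_freeP.
exists (\matrix_(j, b) (j == c b)%:R); apply/matrixP=> a b; rewrite !mxE.
rewrite (bigD1 (c b)) //= !mxE eqxx mulr1 Ec big1 ?addr0 // => j jc.
by rewrite !mxE (negPf jc) mulr0.
Qed.

(** * Deleting row and column [i] *)

Section Deletion.
Variables (n : nat) (i : 'I_n) (A : 'M[R]_n).
Let C := principal_del A i.

Definition extend0 (x : 'I_n.-1 -> R) (k : 'I_n) :=
  if unlift i k is Some l then x l else 0.

Lemma extend0_lift x k : extend0 x (lift i k) = x k.
Proof. by rewrite /extend0 liftK. Qed.

Lemma extend0_del x : extend0 x i = 0.
Proof. by rewrite /extend0 unlift_none. Qed.

Lemma neq_liftP (j : 'I_n) : j != i -> exists k, j = lift i k.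
Proof. by case: (unliftP i j) => [k ->|->]; [exists k | rewrite eqxx]. Qed.

Lemma mxapp_del x j : x i = 0 ->
  mxapp A x (lift i j) = mxapp C (fun k => x (lift i k)) j.
Proof.
move=> xi; rewrite /mxapp (bigD1_ord i) //= xi mulr0 add0r.
by apply: eq_bigr => k _; rewrite !mxE.
Qed.

Lemma mxapp_extend0 x j : mxapp A (extend0 x) (lift i j) = mxapp C x j.
Proof.
rewrite mxapp_del ?extend0_del //.
by apply: eq_bigr => k _; rewrite extend0_lift.
Qed.

Lemma offnull_extend0 x :
  (forall j, mxapp C x j = 0) -> offnull i A (extend0 x).
Proof. by move=> Cx j /neq_liftP[k ->]; rewrite mxapp_extend0. Qed.

(** Extension by zero identifies the kernel of [C] with the [offnull] vectors vanishing at [i]. *)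
Lemma nullity_del_eq k (E : 'I_k -> 'I_n -> R) (c : 'I_k -> 'I_n) :
    (forall a b, E a (c b) = (a == b)%:R) -> (forall b, c b != i) ->
    (forall a, offnull i A (E a)) -> (forall a, E a i = 0) ->
    (forall x, offnull i A x -> x i = 0 ->
       forall j, x j = \sum_a x (c a) * E a j) ->
  nullity C = k.
Proof.
move=> Ec ci VE Ei spanE.
have /fin_all_exists[c' c'E] b := neq_liftP (ci b).
apply: (@nullity_eq _ _ _ (fun a j => E a (lift i j)) c').
- by move=> a b; rewrite -c'E.
- by move=> a j; rewrite -mxapp_del // VE // eq_sym neq_lift.
move=> x Cx j; rewrite -[LHS]extend0_lift spanE ?extend0_del //.
  by apply: eq_bigr => a _; rewrite [in LHS]c'E extend0_lift.
exact: offnull_extend0.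
Qed.

(** The rank hypothesis puts row [i] in the span of the other rows; by symmetry column [i] is a
    combination of the other columns, so dropping it loses no rank. *)
Lemma rank_principal_del : A^T = A -> (\rank A <= \rank (row' i A))%N ->
  (\rank (row' i A) <= \rank C)%N.
Proof.
move=> symA rkA; have sub : (row' i A <= A)%MS.
  by apply/row_subP=> j; rewrite row_rowsub row_sub.
have /submxP[D AD] : (A <= row' i A)%MS.
  by rewrite -(geq_leqif (mxrank_leqif_sup sub)).
suff -> : row' i A = C *m D^T by rewrite mxrankM_maxl.
rewrite -[in LHS]symA {1}AD trmx_mul.
apply/matrixP=> j k; rewrite !mxE; apply: eq_bigr => l _.
by rewrite !mxE -[in LHS]symA mxE.
Qed.

End Deletion.

(** * Bounds on the nullities and necessity of the degree conditions *)

Section Necessity.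
Variables (n : nat) (T : rel 'I_n) (i : 'I_n) (A : 'M[R]_n).
Hypotheses (treeT : tree T) (AT : in_S T A) (snip : SNIP A i).

Lemma SNIP_nullity : (nullity A <= 1)%N \/ (nullity (principal_del A i) <= 1)%N.
Proof.
(* The [offnull] vectors form the kernel of [row' i A], so this bounds their dimension by 2. *)
have rk2 : (n <= \rank (row' i A) + 2)%N.
  rewrite leqNgt; apply/negP=> rk.
  apply: (many_null_not_SNIP treeT AT) snip => j1 j2.
  have [x [Vx x0 xs]] := @ker_vanish _ _ (row' i A) [:: j1; j2] rk.
  exists x; split=> //.
  - move=> j /neq_liftP[r ->]; rewrite -[RHS](Vx r).
    by apply: eq_bigr => k _; rewrite !mxE.
  - by apply: xs; rewrite !inE eqxx.
  - by apply: xs; rewrite !inE eqxx orbT.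
case: (leqP (nullity A) 1) => [|k2]; [by left | right].
have symA : A^T = A by case: AT.
(* Nullity at least 2 puts the rank of [A] at or below [n - 2], hence below or at that of
   [row' i A]; so the principal submatrix, of size [n - 1], has rank at least [n - 2]. *)
have := @rank_principal_del _ i _ symA.
by move: k2 (ltn_ord i); rewrite !nullityE; lia.
Qed.

Lemma SNIP_nullity2 : nullity A = 2%N ->
  exists v, v <> i /\ (3 <= degree T v)%N.
Proof.
rewrite nullityE => k2.
have rk : (\rank A + size [:: i] < n)%N by rewrite /=; lia.
have [w [Aw w0 wi]] := ker_vanish rk.
by apply: (null_vector_high_degree treeT AT snip Aw _ w0); rewrite wi ?inE.
Qed.

(** Extended by zero, the kernel of [C] has dimension 2 and cannot lie in that of [A]. So some [x]
    in it fails in row [i] and is nonzero at a neighbour [q] of [i]; another nonzero kernel vector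
    [w] vanishes at [q]. *)
Lemma SNIP_nullity12 : nullity A = 1%N -> nullity (principal_del A i) = 2%N ->
  exists v, [/\ v <> i, (3 <= degree T v)%N & ~~ T v i].
Proof.
move=> k1 l2; set C := principal_del A i in l2 *.
pose K := kermx C^T; pose J : 'M[R]_(n.-1, n) := row' i 1%:M.
have JE h k : J h k = (lift i h == k)%:R by rewrite !mxE.
have KE r k : (K *m J) r k = extend0 i (K r) k.
  rewrite mxE; case: (unliftP i k) => [l ->|->].
    rewrite extend0_lift (bigD1 l) //= JE eqxx mulr1 big1 ?addr0 // => h hl.
    by rewrite JE (inj_eq lift_inj) (negPf hl) mulr0.
  rewrite extend0_del big1 // => h _.
  by rewrite JE eq_sym (negPf (neq_lift i h)) mulr0.
have freeJ : row_free J.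
  apply/row_freeP; exists (col' i 1%:M); apply/matrixP=> j k.
  rewrite !mxE (bigD1 (lift i j)) //= !mxE eqxx mul1r (inj_eq lift_inj).
  by rewrite big1 ?addr0 // => h hj; rewrite !mxE eq_sym (negPf hj) mul0r.
have [r [j KAj]] : exists r j, (K *m J *m A^T) r j != 0.
  apply/matrix0Pn/eqP => /sub_kermxP/mxrankS.
  by rewrite mxrankMfree // -/(nullity A) k1 -/(nullity C) l2.
pose x := extend0 i (K r).
have Vx : offnull i A x.
  apply: offnull_extend0 => h.
  have /matrixP/(_ r h) := mulmx_ker C^T; rewrite [LHS]mxE [RHS]mxE => <-.
  by apply: eq_bigr => l _; rewrite [C^T _ _]mxE mulrC.
have Ax : (K *m J *m A^T) r j = mxapp A x j.
  by rewrite mxE; apply: eq_bigr => l _; rewrite KE [A^T _ _]mxE mulrC.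
have ji : j = i by apply/eqP; apply: contraNT KAj => /Vx; rewrite Ax => ->.
have [q iq xq] : exists2 q, T i q & x q != 0.
  apply: contrapT => noq; case/eqP: KAj; rewrite Ax ji; apply: big1 => q _.
  have [<-|qi] := eqVneq i q; first by rewrite /x extend0_del mulr0.
  have [iq|/(in_S_nonedge AT qi)->] := boolP (T i q); last by rewrite mul0r.
  have [->|xq] := eqVneq (x q) 0; first by rewrite mulr0.
  by case: noq; exists q.
have [q' qq'] : exists q', q = lift i q'.
  by apply: neq_liftP; rewrite eq_sym (edge_neq treeT iq).
have rk : (\rank C + size [:: q'] < n.-1)%N.
  by move: l2; rewrite nullityE /=; lia.
have [w [Cw [a wa] wq]] := ker_vanish rk.
apply: (@null_vector_far_high_degree _ _ _ _ _ treeT AT q x (extend0 i w)) => //.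
- exact: extend0_del.
- exact: offnull_extend0.
- exact: extend0_del.
- by rewrite qq' extend0_lift wq ?inE.
- by exists (lift i a); rewrite extend0_lift.
Qed.

End Necessity.
End Nullity.

(** * The Laplacian construction *)

Section Construction.
Local Open Scope ring_scope.
Variables (R : realType) (n : nat) (T : rel 'I_n) (i v : 'I_n).
Variables (D : {set 'I_n}) (c0 c1 c2 : 'I_n).
Hypothesis treeT : tree T.

Definition live j := [|| component T D c0 j, component T D c1 j
  | component T D c2 j].

(* On each component of [T - D] this is the graph Laplacian, shifted by the
   identity on the components other than those of [c0], [c1] and [c2]. The
   SNIP ignores the entry [t] added at [(i, i)]. *)
Definition lap (t : R) : 'M[R]_n := \matrix_(j, k)
  if j == k then \sum_h (avoiding T D j h)%:R +
      ((j \notin D) && ~~ live j)%:R + t * (j == i)%:R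
  else - (T j k)%:R.

Definition ind c j : R := (component T D c j)%:R.

Lemma lap_in_S t : in_S T (lap t).
Proof.
split=> [|j k jk]; last by rewrite mxE (negPf jk) oppr_eq0 pnatr_eq0 eqb0 negbK.
apply/matrixP=> j k; rewrite !mxE eq_sym; case: eqP => [->//|_].
by rewrite (tree_sym treeT).
Qed.

Lemma mxapp_lap t x j : mxapp (lap t) x j =
  \sum_k ((avoiding T D j k)%:R * x j - (T j k)%:R * x k) +
  (((j \notin D) && ~~ live j)%:R + t * (j == i)%:R) * x j.
Proof.
rewrite sumrB -mulr_suml /mxapp (bigD1 j) //= mxE eqxx.
rewrite [X in _ - X](bigD1 j) //= (tree_irr treeT) mul0r add0r.
rewrite [X in _ + X = _](eq_bigr (fun k => - ((T j k)%:R * x k))) => [|k kj].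
  by rewrite sumrN; ring.
by rewrite mxE eq_sym (negPf kj) mulNr.
Qed.

Lemma mxapp_lap_shift t x j :
  mxapp (lap t) x j = mxapp (lap 0) x j + t * (j == i)%:R * x j.
Proof. by rewrite !mxapp_lap; ring. Qed.

Lemma offnull_lap t x : offnull i (lap t) x <-> offnull i (lap 0) x.
Proof.
by split=> Vx j ji; move: (Vx j ji);
  rewrite [mxapp (lap t) _ _]mxapp_lap_shift (negPf ji) mulr0 mul0r addr0.
Qed.

(** Dirichlet energy: the quadratic form of [lap 0] vanishes at [x] and is a sum of squares over the
    edges of [T - D] and the shifted vertices. *)
Lemma lap_ker x : {in D, forall j, x j = 0} ->
    (forall j, j \notin D -> mxapp (lap 0) x j = 0) ->
  (forall j k, avoiding T D j k -> x j = x k) /\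
  (forall j, j \notin D -> ~~ live j -> x j = 0).
Proof.
move=> xD Lx.
pose f j k := (avoiding T D j k)%:R * (x j - x k) ^+ 2.
pose g j := ((j \notin D) && ~~ live j)%:R * x j ^+ 2.
have f0 j k : 0 <= f j k by rewrite mulr_ge0 ?ler0n ?sqr_ge0.
have g0 j : 0 <= g j by rewrite mulr_ge0 ?ler0n ?sqr_ge0.
have sf0 j : 0 <= \sum_k f j k by rewrite sumr_ge0.
(* [f] counts each edge twice, hence the factor 2; [h j k + h k j] completes the square. *)
have energy : \sum_j \sum_k f j k + 2 * \sum_j g j = 0.
  pose h j k : R := (avoiding T D j k)%:R * (x j ^+ 2 - x j * x k).
  have -> : \sum_j \sum_k f j k = 2 * \sum_j \sum_k h j k.
    transitivity (\sum_j \sum_k h j k + \sum_j \sum_k h k j); last first.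
      by rewrite [X in _ + X]exchange_big /=; ring.
    rewrite -big_split; apply: eq_bigr => j _.
    rewrite -big_split; apply: eq_bigr => k _.
    by rewrite /f /h (avoiding_sym treeT D k j) /=; ring.
  rewrite -mulrDr -big_split /= big1 ?mulr0 // => j _.
  transitivity (x j * mxapp (lap 0) x j).
    rewrite mxapp_lap mul0r addr0 mulrDr mulr_sumr; congr (_ + _); last first.
      by rewrite /g; ring.
    apply: eq_bigr => k _; rewrite /h /avoiding /=.
    case: (T j k) => /=; last by ring.
    have [jD|jD] := boolP (j \in D); first by rewrite xD //=; ring.
    by have [kD|kD] := boolP (k \in D); [rewrite (xD k) // | rewrite /=]; ring.
  by have [/xD->|/Lx->] := boolP (j \in D); rewrite ?mul0r ?mulr0.
have sf : \sum_j \sum_k f j k = 0.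
  have fge0 : 0 <= \sum_j \sum_k f j k by rewrite sumr_ge0.
  have gge0 : 0 <= \sum_j g j by rewrite sumr_ge0.
  lra.
have sg : \sum_j g j = 0 by move: energy; rewrite sf; lra.
split=> [j k jk | j jD jl].
  have /eqP := sf; rewrite psumr_eq0 // => /allP/(_ j).
  rewrite mem_index_enum => /(_ isT)/=; rewrite psumr_eq0 // => /allP/(_ k).
  rewrite mem_index_enum => /(_ isT)/=.
  by rewrite /f jk mul1r sqrf_eq0 subr_eq0 => /eqP.
have /eqP := sg; rewrite psumr_eq0 // => /allP/(_ j).
rewrite mem_index_enum => /(_ isT)/=.
by rewrite /g jD jl mul1r sqrf_eq0 => /eqP.
Qed.

Lemma lap_ind c j : c \in [:: c0; c1; c2] -> c \notin D ->
  j \notin D -> mxapp (lap 0) (ind c) j = 0.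
Proof.
move=> cs cD jD; rewrite mxapp_lap mul0r addr0 big1 => [|k _].
  rewrite add0r jD /ind /=; case cj: (component T D c j); last by rewrite mulr0.
  suff -> : live j by rewrite mul0r.
  by move: cs; rewrite /live !inE => /or3P[]/eqP<-; rewrite cj ?orbT.
rewrite /avoiding /= jD /=; case Tjk: (T j k); last by rewrite !mul0r subr0.
have [kD|kD] /= := boolP (k \in D).
  rewrite mul0r mul1r sub0r /ind; case ck: (component T D c k); rewrite ?oppr0 //.
  by have := component_notin cD ck; rewrite kD.
suff -> : ind c j = ind c k by rewrite subrr.
have av : avoiding T D j k by rewrite /avoiding /= Tjk jD.
congr (_%:R); congr nat_of_bool.
exact: (same_connect1r (sym_connect_sym (avoiding_sym treeT D)) av).
Qed.

(** The diagonal entry at [j] is 0, and acyclicity allows [j] a single neighbour in the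
    component. *)
Lemma lap_ind_adj c j q : j \in D -> T j q -> component T D c q ->
  mxapp (lap 0) (ind c) j = -1.
Proof.
move=> jD jq cq; rewrite mxapp_lap jD mul0r addr0 mul0r addr0.
rewrite (bigD1 q) //= /avoiding /= jD andbF jq mul0r sub0r mul1r /ind cq.
rewrite big1 ?addr0 // => k kq; rewrite andbF mul0r sub0r.
case jk: (T j k); last by rewrite mul0r oppr0.
case ck: (component T D c k); last by rewrite mulr0 oppr0.
suff qk : q = k by rewrite qk eqxx in kq.
apply: (component_neighbor treeT jD jq jk); apply: connect_trans ck.
by rewrite -/(component T D q c) (component_sym treeT).
Qed.

Lemma lap_ind_nonadj c j : j \in D -> (forall k, T j k -> ~~ component T D c k) ->
  mxapp (lap 0) (ind c) j = 0.
Proof.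
move=> jD cj; rewrite mxapp_lap jD mul0r addr0 mul0r addr0.
apply: big1 => k _; rewrite /avoiding /= jD andbF mul0r sub0r.
by case jk: (T j k); rewrite /ind ?(negPf (cj _ jk)) ?mulr0 ?mul0r oppr0.
Qed.

Hypotheses (vD : v \in D) (vi : v != i).
Hypotheses (vc0 : T v c0) (vc1 : T v c1) (vc2 : T v c2).
Hypotheses (c0D : c0 \notin D) (c1D : c1 \notin D) (c2D : c2 \notin D).
Hypotheses (c01 : c0 != c1) (c02 : c0 != c2) (c12 : c1 != c2).
(** Checked separately for each choice of [D], by pairing with indicators. *)
Hypothesis offnull_lap_ker : forall x, offnull i (lap 0) x ->
  {in D, forall j, x j = 0} /\ forall j, j \notin D -> mxapp (lap 0) x j = 0.

Lemma ind_root c : ind c c = 1.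
Proof. by rewrite /ind component_root. Qed.

Lemma ind_disjoint c c' j : T v c -> T v c' -> c != c' ->
  component T D c j -> ind c' j = 0.
Proof.
move=> vc vc' cc' cj; rewrite /ind; case c'j: (component T D c' j) => //.
have/eqP := cc'; case; apply: (component_neighbor treeT vD vc vc').
apply: connect_trans cj _.
by rewrite -/(component T D j c') (component_sym treeT).
Qed.

Lemma ind_other c c' : T v c -> T v c' -> c != c' -> ind c' c = 0.
Proof.
by move=> vc vc' cc'; apply: ind_disjoint cc' _ => //; apply: component_root.
Qed.

Lemma offnull_decomp x : offnull i (lap 0) x ->
  forall j, x j = x c0 * ind c0 j + x c1 * ind c1 j + x c2 * ind c2 j.
Proof.
move=> Vx j; have [xD Lx] := offnull_lap_ker Vx.
have [xconst xdead] := lap_ker xD Lx.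
have const c : component T D c j -> x j = x c.
  move=> /connectP[s sP ->]; elim: s c sP => //= k s IHs c /andP[ck ks].
  by rewrite (xconst _ _ ck) IHs.
have [jD|jD] := boolP (j \in D).
  have ind0 c : c \notin D -> ind c j = 0.
    move=> cD; rewrite /ind; case cj: (component T D c j) => //.
    by have := component_notin cD cj; rewrite jD.
  by rewrite xD // !ind0 // !mulr0 !addr0.
have [|jl] := boolP (live j).
  have ind1 c : component T D c j -> ind c j = 1 by rewrite /ind => ->.
  case/or3P=> cj; rewrite (const _ cj) (ind1 _ cj).
  - by rewrite (ind_disjoint vc0 vc1) // (ind_disjoint vc0 vc2) //; ring.
  - rewrite (ind_disjoint vc1 vc0) 1?eq_sym // (ind_disjoint vc1 vc2) //; ring.
  - rewrite (ind_disjoint vc2 vc0) 1?eq_sym //.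
    by rewrite (ind_disjoint vc2 vc1) 1?eq_sym //; ring.
move: (jl); rewrite xdead // /live !negb_or /ind.
case/and3P=> /negPf-> /negPf-> /negPf->.
by rewrite !mulr0 !addr0.
Qed.

Lemma mxapp_decomp x j : offnull i (lap 0) x ->
  mxapp (lap 0) x j = x c0 * mxapp (lap 0) (ind c0) j +
    x c1 * mxapp (lap 0) (ind c1) j + x c2 * mxapp (lap 0) (ind c2) j.
Proof.
move=> Vx; rewrite !mulr_sumr -!big_split /=; apply: eq_bigr => k _.
by rewrite (offnull_decomp Vx k); ring.
Qed.

Lemma lap_ind_center c : T v c -> mxapp (lap 0) (ind c) v = -1.
Proof. by move=> vc; apply: lap_ind_adj vc _ => //; apply: component_root. Qed.

(** This is row [v] of [lap 0], available because [v != i]. *)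
Lemma offnull_sum x : offnull i (lap 0) x -> x c2 = - (x c0 + x c1).
Proof.
move=> Vx; have := mxapp_decomp v Vx; rewrite Vx // !lap_ind_center //.
by lra.
Qed.

(* A column of [X] is determined by its entries at [c0], [c1], [c2], which sum
   to zero; a symmetric 3x3 matrix with zero diagonal and zero row sums is 0. *)
Lemma lap_SNIP t : SNIP (lap t) i.
Proof.
move=> X symX _ diagX LX.
have VX k : offnull i (lap 0) (fun j => X j k).
  apply/(offnull_lap t) => j /neq_liftP[l ->].
  by have /matrixP/(_ l k) := LX; rewrite !mxE.
have XC j k : X j k = X k j by have /matrixP/(_ j k) := symX; rewrite mxE.
have X0 j : X j j = 0.
  by have /matrixP/(_ j j) := diagX; rewrite !mxE eqxx mul1r.
have E0 := offnull_sum (VX c0); have E1 := offnull_sum (VX c1).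
have E2 := offnull_sum (VX c2).
rewrite /= !X0 (XC c1 c0) (XC c2 c0) (XC c2 c1) in E0 E1 E2.
have X01 : X c0 c1 = 0 by lra.
have X02 : X c0 c2 = 0 by lra.
have X12 : X c1 c2 = 0 by lra.
have XE j k := offnull_decomp (VX k) j; apply/matrixP=> j k; rewrite mxE.
rewrite XE (XC c0 k) (XC c1 k) (XC c2 k) !(XE k) !X0.
by rewrite (XC c1 c0) (XC c2 c0) (XC c2 c1) X01 X02 X12; ring.
Qed.

Definition basis_vec c j := ind c j - ind c2 j.

Lemma mxapp_basis c j : mxapp (lap 0) (basis_vec c) j =
  mxapp (lap 0) (ind c) j - mxapp (lap 0) (ind c2) j.
Proof.
rewrite -sumrB; apply: eq_bigr => k _; rewrite /basis_vec; ring.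
Qed.

(** Row [v] cancels because both indicators contribute -1 there. *)
Lemma basis_ker c j : c \in [:: c0; c1] -> j \notin D :\ v ->
  mxapp (lap 0) (basis_vec c) j = 0.
Proof.
rewrite !inE negb_and negbK mxapp_basis => cs /predU1P[->|jD].
  rewrite !lap_ind_center ?subrr //.
  by case/orP: cs => /eqP->.
rewrite !lap_ind ?subrr // ?inE ?eqxx ?orbT //.
- by case/orP: cs => /eqP->; rewrite eqxx ?orbT.
- by case/orP: cs => /eqP->.
Qed.

Definition basis_root (a : 'I_2) := if a == ord0 then c0 else c1.

Lemma basis_root_in a : basis_root a \in [:: c0; c1].
Proof. by rewrite /basis_root !inE; case: ifP; rewrite eqxx ?orbT. Qed.

Lemma basis_dual a b : basis_vec (basis_root a) (basis_root b) = (a == b)%:R.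
Proof.
have E c : T v c -> c != c2 -> basis_vec c c = 1.
  by move=> vc cc2; rewrite /basis_vec ind_root ind_other // subr0.
have E' c c' : T v c -> T v c' -> c != c' -> c' != c2 -> basis_vec c c' = 0.
  move=> vc vc' cc' c'c2.
  by rewrite /basis_vec ind_other 1?eq_sym // ind_other // subr0.
rewrite /basis_root; case: a b => [[|[|//]] ?] [[|[|//]] ?] /=.
- exact: E.
- exact: E'.
- by apply: E' => //; rewrite eq_sym.
- exact: E.
Qed.

Lemma basis_span x j : offnull i (lap 0) x ->
  x j = \sum_a x (basis_root a) * basis_vec (basis_root a) j.
Proof.
move=> Vx; rewrite !big_ord_recl big_ord0 /= addr0.
rewrite (offnull_decomp Vx j) (offnull_sum Vx) /basis_vec; ring.
Qed.

Lemma basis_span1 x j : offnull i (lap 0) x -> x c0 = 0 ->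
  x j = \sum_(a < 1) x c1 * basis_vec c1 j.
Proof.
move=> Vx x0; rewrite big_ord1.
rewrite (offnull_decomp Vx j) (offnull_sum Vx) x0 /basis_vec; ring.
Qed.

Lemma basis_dual1 (a b : 'I_1) : basis_vec c1 c1 = (a == b)%:R.
Proof.
by rewrite !ord1 eqxx; have := basis_dual (lift ord0 ord0) (lift ord0 ord0).
Qed.

End Construction.

(** * Realising the nullity pairs (2, 1), (1, 1) and (1, 2) *)

Section Sufficiency.
Local Open Scope ring_scope.
Variables (R : realType) (n : nat) (T : rel 'I_n) (i v : 'I_n).
Hypotheses (treeT : tree T) (vi : v != i) (deg3 : (3 <= degree T v)%N).

Lemma three_branches : exists c0 c1 c2,
  [/\ [/\ T v c0, T v c1 & T v c2], [/\ c0 != c1, c0 != c2 & c1 != c2]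
    & branch T v c0 i].
Proof.
have [|c0 vc0 c0i] := @branchP _ _ treeT v i; first by rewrite eq_sym.
have : (1 < #|[predD1 [pred w | T v w] & c0]|)%N.
  by move: deg3; rewrite /degree (cardD1 c0) inE vc0.
case/card_gt1P=> c1 [c2 []]; rewrite !inE => /andP[c10 vc1] /andP[c20 vc2] c12.
by exists c0, c1, c2; split=> //; split=> //; rewrite eq_sym.
Qed.

Lemma near_construction : allows_SNIP R T i 2 1 /\ allows_SNIP R T i 1 1.
Proof.
have [c0 [c1 [c2 [[vc0 vc1 vc2] [c01 c02 c12] c0i]]]] := three_branches.
pose D := [set v]; have vD : v \in D by rewrite inE.
have notD c : T v c -> c \notin D.
  by move=> vc; rewrite inE eq_sym (edge_neq treeT).
have [c0D c1D c2D] := And3 (notD _ vc0) (notD _ vc1) (notD _ vc2).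
pose L := lap T i D c0 c1 c2 : R -> 'M[R]_n.
have L0S : in_S T (L 0) by apply: lap_in_S.
have ind_i c : c != c0 -> T v c -> ind R T D c i = 0.
  by move=> cc0 vc; apply: (ind_disjoint R treeT vD vc0); rewrite // eq_sym.
have ind0_i : ind R T D c0 i = 1 by rewrite /ind -/(branch T v c0 i) c0i.
(* By symmetry of [L 0]: tested against [ind c], the image of [x] survives only at [i], while the
   image of [ind c] meets [x] only at [v]. *)
have pairing c x : T v c -> c \in [:: c0; c1; c2] -> offnull i (L 0) x ->
    ind R T D c i * mxapp (L 0) x i = - x v.
  move=> vc cs Vx; have := mxapp_sym L0S x (ind R T D c).
  rewrite (bigD1 i) //= big1 ?addr0 => [->|j /Vx->]; last by rewrite mulr0.
  rewrite (bigD1 v) //= big1 => [|j jv].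
    by rewrite (lap_ind_center R _ _ _ _ treeT vD vc) addr0 mulN1r.
  by rewrite lap_ind ?mul0r ?(notD c vc) // inE.
(* The component of [c1] misses [i], which gives [x v = 0]; that of [c0] contains [i], which then
   gives row [i]. *)
have kerL x : offnull i (L 0) x ->
    x v = 0 /\ forall j, mxapp (L 0) x j = 0.
  move=> Vx; have xv : x v = 0.
    have := pairing c1 x vc1; rewrite !inE eqxx orbT ind_i 1?eq_sym // mul0r.
    by move=> /(_ isT Vx)/eqP; rewrite eq_sym oppr_eq0 => /eqP.
  split=> // j; have [->|/Vx//] := eqVneq j i.
  have := pairing c0 x vc0; rewrite !inE eqxx ind0_i mul1r xv oppr0.
  exact.
have offker x : offnull i (L 0) x ->
    {in D, forall j, x j = 0} /\ forall j, j \notin D -> mxapp (L 0) x j = 0.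
  by move=> /kerL[xv Lx]; split=> [j|j _]; rewrite // inE => /eqP->.
have dual := basis_dual R treeT vD vc0 vc1 vc2 c01 c02 c12.
have dual1 := basis_dual1 R treeT vD vc0 vc1 vc2 c01 c02 c12.
have span := basis_span treeT vD vi vc0 vc1 vc2 c0D c1D c2D c01 c02 c12 offker.
have span1 := basis_span1 treeT vD vi vc0 vc1 vc2 c0D c1D c2D c01 c02 c12 offker.
have snip := lap_SNIP treeT vD vi vc0 vc1 vc2 c0D c1D c2D c01 c02 c12 offker.
have bker c j : c \in [:: c0; c1] -> mxapp (L 0) (basis_vec R T D c2 c) j = 0.
  by move=> cs; apply: (basis_ker R i treeT vD vc0 vc1 vc2 c0D c1D c2D cs);
    rewrite !inE; case: (j == v).
have xi x : offnull i (L 0) x -> x i = x c0.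
  move=> Vx; rewrite [LHS](offnull_decomp treeT vD vc0 vc1 vc2 c0D c1D c2D
    c01 c02 c12 offker Vx).
  by rewrite ind0_i !ind_i 1?eq_sym //; ring.
have bi : basis_vec R T D c2 c1 i = 0.
  by rewrite /basis_vec !ind_i 1?eq_sym // subrr.
have c1i : c1 != i.
  apply: contraNneq c01 => c1i; rewrite -c1i in c0i.
  by rewrite (branch_exit treeT vc0 c0i vc1).
(* Deletion removes the entry with [t], and [x i = 0] amounts to [x c0 = 0], which leaves a line. *)
have del1 t : nullity (principal_del (L t) i) = 1%N.
  apply: (@nullity_del_eq _ _ _ _ 1 (fun=> basis_vec R T D c2 c1)
    (fun=> c1)) => //.
  - move=> _; apply/offnull_lap => // j _; apply: bker.
    by rewrite !inE eqxx orbT.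
  - move=> x /offnull_lap-/(_ treeT) Vx x0 j.
    by apply: span1 => //; rewrite -xi.
split.
  exists (L 0); split=> //.
  apply: (@nullity_eq _ _ _ _ (fun a => basis_vec R T D c2 (basis_root c0 c1 a))
    (basis_root c0 c1)).
  - exact: dual.
  - by move=> a j; apply: bker; apply: basis_root_in.
  - by move=> x Lx j; apply: span.
exists (L 1); split=> //.
- exact: lap_in_S.
apply: (@nullity_eq _ _ _ _ (fun=> basis_vec R T D c2 c1) (fun=> c1)).
- exact: dual1.
- move=> _ j; rewrite mxapp_lap_shift // bker ?inE ?eqxx ?orbT // add0r.
  by have [->|_] := eqVneq j i; rewrite ?bi ?mulr0 // mul0r.
move=> x Lx j.
have Vx : offnull i (L 0) x.
  by apply/(offnull_lap i D c0 c1 c2 treeT 1) => k _; apply: Lx.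
apply: span1 => //.
(* Row [i] of [L 1] reduces to [x i = 0]. *)
rewrite -xi //; have := Lx i; rewrite mxapp_lap_shift // (kerL _ Vx).2 eqxx.
by rewrite add0r !mul1r.
Qed.

(** [q] is the penultimate vertex of a repetition-free path. It supplies the neighbour of [i] in the
    component of [c0] once [i] is removed too. *)
Lemma last_step (D : {set 'I_n}) c x : component T D c x -> c != x ->
  exists2 q, T x q & component T (x |: D) c q.
Proof.
move=> /connectP[s0 s0P xl] cx; case/shortenP: s0P xl => s sP us _ xl.
case/lastP: s sP us xl => [|s y] sP us.
  by move=> /eqP; rewrite eq_sym (negPf cx).
rewrite last_rcons => xy; rewrite -{y}xy in sP us *.
move: sP; rewrite rcons_path => /andP[sP /and3P[qx _ _]].
exists (last c s); first by rewrite (tree_sym treeT).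
apply/connectP; exists s => //.
move: us; rewrite -rcons_cons rcons_uniq => /andP[xs _].
elim: s c {cx qx} sP xs => //= y s IHs c /andP[/and3P[cy cD yD] ys].
rewrite !inE !negb_or => /and3P[xc xy xs].
rewrite IHs // ?inE ?negb_or ?xy // andbT /avoiding /= cy !inE !negb_or.
by rewrite cD yD ![_ == x]eq_sym xc xy.
Qed.

Lemma far_construction : ~~ T v i -> allows_SNIP R T i 1 2.
Proof.
move=> nvi.
have [c0 [c1 [c2 [[vc0 vc1 vc2] [c01 c02 c12] c0i]]]] := three_branches.
pose D := [set i; v]; have vD : v \in D by rewrite !inE eqxx orbT.
have iD : i \in D by rewrite !inE eqxx.
have notD c : T v c -> c \notin D.
  move=> vc; rewrite !inE negb_or [c == v]eq_sym (edge_neq treeT vc) andbT.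
  by apply: contraNneq nvi => <-.
have [c0D c1D c2D] := And3 (notD _ vc0) (notD _ vc1) (notD _ vc2).
have cNi c : T v c -> c != i by move=> /notD; rewrite !inE negb_or => /andP[].
have [q iq c0q] := last_step c0i (cNi _ vc0).
rewrite -/D in c0q.
pose L := lap T i D c0 c1 c2 0 : 'M[R]_n.
have LS : in_S T L by apply: lap_in_S.
have Li0 : mxapp L (ind R T D c0) i = -1.
  exact: (lap_ind_adj R _ _ _ _ treeT iD iq c0q).
(* A component containing a neighbour of [i] lies in the branch at [v] that contains [i], which is
   that of [c0]. *)
have Li c : c != c0 -> T v c -> mxapp L (ind R T D c) i = 0.
  move=> cc0 vc; apply: lap_ind_nonadj => // k ik; apply/negP=> ck.
  have {}ck : branch T v c k.
    by apply: component_sub ck; rewrite sub1set.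
  have ki : T k i by rewrite (tree_sym treeT).
  have ci : branch T v c i by apply: (branch_step treeT vc ck ki); rewrite eq_sym.
  by rewrite (branch_inj treeT vc vc0 ci c0i) eqxx in cc0.
have ind_i c : T v c -> ind R T D c i = 0.
  move=> vc; rewrite /ind; case ci: (component T D c i) => //.
  by have := component_notin (notD _ vc) ci; rewrite iD.
have pairing c x : T v c -> c \in [:: c0; c1; c2] -> offnull i L x ->
    mxapp L (ind R T D c) i * x i = x v.
  move=> vc cs Vx; have := mxapp_sym LS x (ind R T D c).
  rewrite (bigD1 i) //= ind_i // mul0r add0r.
  rewrite big1 => [/esym|j /Vx->]; last by rewrite mulr0.
  rewrite (bigD1 i) //= (bigD1 v) //= (lap_ind_center R _ _ _ _ treeT vD vc).
  rewrite big1 => [|j /andP[ji jv]]; first by lra.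
  by rewrite lap_ind ?mul0r ?(notD c vc) // !inE negb_or ji.
(* Pairing with [c1] gives [x v = 0]; pairing with [c0], whose indicator yields -1 in row [i], then
   gives [x i = 0]. *)
have offker x : offnull i L x ->
    {in D, forall j, x j = 0} /\ forall j, j \notin D -> mxapp L x j = 0.
  move=> Vx; have xv : x v = 0.
    by rewrite -(pairing c1) ?inE ?eqxx ?orbT // Li 1?eq_sym // mul0r.
  have xi : x i = 0.
    have := pairing c0 x vc0; rewrite !inE eqxx Li0 xv => /(_ isT Vx); lra.
  split=> [j|j]; rewrite !inE; first by case/orP=> /eqP->.
  by rewrite negb_or => /andP[/Vx].
have dual := basis_dual R treeT vD vc0 vc1 vc2 c01 c02 c12.
have dual1 := basis_dual1 R treeT vD vc0 vc1 vc2 c01 c02 c12.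
have span := basis_span treeT vD vi vc0 vc1 vc2 c0D c1D c2D c01 c02 c12 offker.
have span1 := basis_span1 treeT vD vi vc0 vc1 vc2 c0D c1D c2D c01 c02 c12 offker.
have snip := lap_SNIP treeT vD vi vc0 vc1 vc2 c0D c1D c2D c01 c02 c12 offker.
have bker c j : c \in [:: c0; c1] -> j != i ->
    mxapp L (basis_vec R T D c2 c) j = 0.
  by move=> cs ji; apply: (basis_ker R i treeT vD vc0 vc1 vc2 c0D c1D c2D cs);
    rewrite !inE (negPf ji); case: (j == v).
have b_i c : T v c -> basis_vec R T D c2 c i = 0.
  by move=> vc; rewrite /basis_vec !ind_i // subrr.
exists L; split=> //.
- exact: snip.
- apply: (@nullity_eq _ _ _ _ (fun=> basis_vec R T D c2 c1) (fun=> c1)).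
  + exact: dual1.
  + move=> _ j; have [->|ji] := eqVneq j i.
      by rewrite mxapp_basis !Li 1?eq_sym // subrr.
    by apply: bker ji; rewrite !inE eqxx orbT.
  move=> x Lx j; have Vx : offnull i L x by move=> k _.
  apply: span1 => //.
  (* Row [i] reads [- x c0 = 0], the extra condition that cuts the dimension to 1. *)
  have := mxapp_decomp treeT vD vc0 vc1 vc2 c0D c1D c2D c01 c02 c12 offker i Vx.
  by rewrite Lx Li0 !Li 1?eq_sym //; lra.
(* Every [offnull] vector vanishes at [i] here, so deletion keeps the whole two-dimensional
   space. *)
apply: (@nullity_del_eq _ _ _ _ _
    (fun a => basis_vec R T D c2 (basis_root c0 c1 a)) (basis_root c0 c1)).
- exact: dual.
- by move=> b; rewrite /basis_root; case: ifP => _; apply: cNi.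
- by move=> a j; apply: bker; apply: basis_root_in.
- by move=> a; rewrite /basis_root; case: ifP => _; apply: b_i.
move=> x Vx _ j.
exact: span.
Qed.

End Sufficiency.

Theorem theorem5p12 (R : realType) (n : nat) (T : rel 'I_n) (i : 'I_n)
    (n_ge2 : 2 <= n) (treeT : tree T) (T_not_path : ~ graph_iso T (path_graph n)) :
  [/\ forall k l : nat, allows_SNIP R T i k l -> k <= 1 \/ l <= 1,
      (allows_SNIP R T i 2 1 /\ allows_SNIP R T i 1 1) <->
        (exists v : 'I_n, v <> i /\ 3 <= degree T v)
    & allows_SNIP R T i 1 2 <->
        (exists v : 'I_n, [/\ v <> i, 3 <= degree T v & ~~ T v i])].
Proof.
split.
- by move=> k l [A [AT snip <- <-]]; apply: SNIP_nullity AT snip.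
- split=> [[[A [AT snip k2 _]] _]|[v [/eqP vi deg3]]].
    exact: SNIP_nullity2 AT snip k2.
  exact: near_construction deg3.
- split=> [[A [AT snip k1 l2]]|[v [/eqP vi deg3 nvi]]].
    exact: SNIP_nullity12 AT snip k1 l2.
  exact: far_construction deg3 nvi.
Qed.
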